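(* Let $\mathcal{P}=(\mathcal{PV},\mathcal{L},\ell_0,\mathcal{T})$ be an integer program and $\mathcal{PV}'=\{x_1,\ldots,x_d\}\subseteq\mathcal{PV}$. Let $t=(\ell,\varphi,\eta,\ell)\in\mathcal{T}$ with $\varphi\in\mathcal{F}(\mathcal{PV}')$, $\eta(v)\in\mathbb{Z}[\mathcal{PV}']$ for all $v\in\mathcal{PV}'$, and $\eta(v)=v$ for all $v\in\mathcal{PV}\setminus\mathcal{PV}'$. For each entry transition $r\in\mathcal{E}_{\{t\}}$ let $\psi_r\in\mathcal{F}(\mathcal{PV}')$ be such that $\models\psi_r\to\eta(\psi_r)$ and $\sigma(\psi_r)$ holds whenever there is a state $\sigma_0$ with $(\ell_0,\sigma_0)\to^*_{\mathcal{T}}\circ\to_r(\ell,\sigma)$, and let $L_r=(\psi_r,\varphi,\eta|_{\mathcal{PV}'})$. Define ${\mathcal{RB}_{\text{loc}}}(r)={\operatorname{sth}^{\sqcup}}$ if $L_r$ is a terminating tnn-loop, where ${\operatorname{sth}^{\sqcup}}$ is a stabilization bound polynomial of $L_r$; ${\mathcal{RB}_{\text{loc}}}(r)=2\cdot{\operatorname{sth}^{\sqcup}}+1$ if $L_r$ is a terminating twn-loop but not a tnn-loop, where ${\operatorname{sth}^{\sqcup}}$ is a stabilization bound polynomial of $L_r\star L_r$; and ${\mathcal{RB}_{\text{loc}}}(r)=\omega$ otherwise. Then ${\mathcal{RB}_{\text{loc}}}:\mathcal{E}_{\{t\}}\to\mathcal{B}$ is a local runtime bound for $\{t\}=\mathcal{T}'_>=\mathcal{T}'$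 in $\mathcal{P}$.
   Context: Integer programs: $\mathcal{F}(\mathcal{V})$ are propositional formulas ($\land,\lor$) over atoms $q_1<q_2$, $q_i\in\mathbb{Z}[\mathcal{V}]$. An integer program $(\mathcal{PV},\mathcal{L},\ell_0,\mathcal{T})$ has a finite set $\mathcal{PV}\subseteq\mathcal{V}$ of program variables, finite locations $\mathcal{L}$ with initial $\ell_0$, and finite transitions $(\ell,\varphi,\eta,\ell')$ with $\ell'\neq\ell_0$, guard $\varphi\in\mathcal{F}(\mathcal{V})$, update $\eta:\mathcal{PV}\to\mathbb{Z}[\mathcal{V}]$. States are $\sigma:\mathcal{V}\to\mathbb{Z}$; $|\sigma|(v)=|\sigma(v)|$; $(\ell,\sigma)\to_s(\ell',\sigma')$ for $s=(\ell,\varphi,\eta,\ell')$ iff $\sigma(\varphi)$ holds and $\sigma'(v)=\sigma(\eta(v))$ for $v\in\mathcal{PV}$; $\to_{\mathcal{T}}$ is the union over $\mathcal{T}$, $\to^*$ its reflexive-transitive closure. Bounds $\mathcal{B}$: smallest set containing $\mathbb{N}\cup\{\omega\}$ and $\mathcal{PV}$, closed under $+$, $\cdot$, $k^{b}$ ($k\in\mathbb{N}$). $\mathcal{E}_{\mathcal{T}'}$: transitions in $\mathcal{T}\setminus\mathcal{T}'$ whose target is the start location of a transition of $\mathcal{T}'$. A local runtime bound for $\mathcal{T}'_>$ w.r.t. $\mathcal{T}'$ is ${\mathcal{RB}_{\text{loc}}}:\mathcal{E}_{\mathcal{T}'}\to\mathcal{B}$ with $|\sigma|({\mathcal{RB}_{\text{loc}}}(r))\ge\sup\{k\mid\exists\sigma_0,\ell'',(\ell',\sigma').\,(\ell_0,\sigma_0)\to^*_{\mathcal{T}}\circ\to_r(\ell'',\sigma)(\to^*_{\mathcal{T}'}\circ\to_s)^k(\ell',\sigma')\}$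 for all $s\in\mathcal{T}'_>$, $r\in\mathcal{E}_{\mathcal{T}'}$, states $\sigma$. Twn-loops: $(\psi,\varphi,\eta)$ over $\{x_1,\ldots,x_d\}$ is the program with transitions $(\ell_0,\psi,\mathrm{id},\ell)$ and $(\ell,\varphi,\eta,\ell)$, with $\models\psi\to\eta(\psi)$ and $\eta(x_i)=c_ix_i+p_i$, $c_i\in\mathbb{Z}$, $p_i\in\mathbb{Z}[x_{i+1},\ldots,x_d]$; tnn-loop if all $c_i\ge0$; terminating if it has no infinite evaluation. $L\star L$ for $L=(\psi,\varphi,\eta)$ is $(\psi,\varphi\land\eta(\varphi),\eta\circ\eta)$. Stabilization bound polynomial of a terminating tnn-loop $L=(\psi,\varphi,\eta)$: let $\psi'=\psi\land\varphi$, $\Psi'=\{\vec e\in\mathbb{Z}^d\mid\sigma_{\vec e}(\psi')\}$ with $\sigma_{\vec e}(x_i)=e_i$. Take a normalized closed form $\overline{\vec x}$ of $\eta$ with start value $n_0$ (expressions over $\vec x$ and $n$ with $\sigma(\overline{x_i})=\sigma(\eta^n(x_i))$ whenever $\sigma(n)\ge n_0$) whose components are of the form $\sum_j p_j n^{a_j}b_j^n$, $p_j\in\mathbb{Q}[\vec x]$, $a_j\in\mathbb{N}$, $b_j\in\mathbb{N}_{\ge1}$. For each atom $\alpha=(s_1<s_2)$ of $\varphi$, $npe_\alpha$ is $(s_2-s_1)[\vec x/\overline{\vec x}]$ multiplied by the lcm of its denominators, written as $\sum_{(p,a,b)\in\Lambda}p\,n^ab^n$ with monomials $p$. Choose disjoint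 $\Delta,\Gamma\subseteq\Lambda$ with $\models\psi'\to p>0$ on $\Delta$, $\models\psi'\to p\le0$ on $\Gamma$, and $i_{(p,a,b)},j_{(p,a,b)}\in\mathbb{N}$ with $(j,i)>_{\mathrm{lex}}(b,a)$ on $\Delta$, $(b,a)>_{\mathrm{lex}}(j,i)$ on $\Gamma$ ($>_{\mathrm{lex}}$ lexicographic on pairs); set $\overline{npe_\alpha}=\sum_{\Delta\cup\Gamma}p\,n^{i}j^n+\sum_{\Lambda\setminus(\Delta\cup\Gamma)}p\,n^ab^n$, required to be eventually non-positive (if $\overline{npe_\alpha}\ne npe_\alpha$, then for each $\vec e\in\Psi'$, $\sigma_{\vec e}(\overline{npe_\alpha})\le0$ for all large $n$). The $k$-monotonicity threshold of $(b_1,a_1)>_{\mathrm{lex}}(b_2,a_2)$ is the least $n_0$ with $n^{a_1}b_1^n>k\,n^{a_2}b_2^n$ for all $n\ge n_0$. $D_\alpha$ is the max ($\max\emptyset=0$) of the 1-monotonicity thresholds of $(j,i),(b,a)$ over $\Delta$ and $(b,a),(j,i)$ over $\Gamma$. Write $\overline{npe_\alpha}=\sum_{j=1}^{\ell}p_jn^{a_j}b_j^n$ with $p_j\ne0$, $(b_\ell,a_\ell)>_{\mathrm{lex}}\cdots>_{\mathrm{lex}}(b_1,a_1)$; $C_\alpha=\max\{1,N_2,M_2,\ldots,N_\ell,M_\ell\}$ with $M_j=0$ if $b_j=b_{j-1}$, else the 1-monotonicity threshold of $(b_j,a_j)$ and $(b_{j-1},a_{j-1}+1)$; $N_2=1$,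 $N_3=mt'$, $N_j=\max\{mt,mt'\}$ ($j>3$), $mt'$ the $(j-2)$-monotonicity threshold of $(b_{j-1},a_{j-1})$ and $(b_{j-2},a_{j-2})$, $mt$ the max of the 1-monotonicity thresholds of $(b_{j-2},a_{j-2})$ and $(b_i,a_i)$, $1\le i\le j-3$. With $Pol=\bigcup_\alpha\{p_1,\ldots,p_{\ell-1}\}$, $C=\max_\alpha C_\alpha$, $D=\max_\alpha D_\alpha$, the polynomial is $2\cdot\sqcup Pol+\max\{n_0,C,D\}$, where $\sqcup\{q_1,\ldots,q_m\}=\sum_{\vec e}c_{\vec e}\vec x^{\vec e}$ with $c_{\vec e}$ the maximal absolute coefficient of monomial $\vec x^{\vec e}$ among the $q_k$ ($0$ if none). *)

(* Defs.v *)
From Stdlib Require List.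
From Stdlib Require Import Relation_Operators.
From HB Require Import structures.
From mathcomp Require Import all_boot all_order all_algebra.
From mathcomp Require Import finmap.
From mathcomp Require Import monalg.

Set Implicit Arguments.
Unset Strict Implicit.
Unset Printing Implicit Defensive.

Import Order.TTheory GRing.Theory Num.Theory.

Local Open Scope fset_scope.
Local Open Scope ring_scope.

(* R[V] for an arbitrary, possibly infinite, set V of variables *)
Notation mpol R V := {malg R[{cmonom V}]}.

Section Poly.
Context {V : choiceType}.

Definition pvar {R : comNzRingType} (v : V) : mpol R V := << ucm v >>.

Definition moneval {S : comNzRingType} (h : V -> S) (m : {cmonom V}) : S :=
  \prod_(v <- finsupp m) h v ^+ m v.

Definition peval {R : comNzRingType} (s : V -> R) (p : mpol R V) : R :=
  mmap idfun (moneval s) p.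

Definition psubst {W : choiceType} (th : V -> mpol int W) (p : mpol int V) :
    mpol int W :=
  mmap (fun c : int => c%:MP) (moneval th) p.

End Poly.

(* (q1, q2) stands for q1 < q2 *)
Notation atom V := (mpol int V * mpol int V)%type.

Inductive formula (V : choiceType) : Type :=
| Atom of mpol int V & mpol int V
| And of formula V & formula V
| Or of formula V & formula V.

Section FormulaChoice.
Variable V : choiceType.

Fixpoint formula_code (f : formula V) : GenTree.tree (atom V) :=
  match f with
  | Atom p q => GenTree.Leaf (p, q)
  | And f g => GenTree.Node 0 [:: formula_code f; formula_code g]
  | Or f g => GenTree.Node 1 [:: formula_code f; formula_code g]
  end.

Fixpoint formula_decode (c : GenTree.tree (atom V)) :
    option (formula V) :=
  match c with
  | GenTree.Leaf (p, q) => Some (Atom p q)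
  | GenTree.Node 0 [:: c1; c2] =>
      if (formula_decode c1, formula_decode c2) is (Some f, Some g)
      then Some (And f g) else None
  | GenTree.Node 1 [:: c1; c2] =>
      if (formula_decode c1, formula_decode c2) is (Some f, Some g)
      then Some (Or f g) else None
  | _ => None
  end.

Lemma formula_codeK : pcancel formula_code formula_decode.
Proof. by elim=> [p q|f IHf g IHg|f IHf g IHg] //=; rewrite IHf IHg. Qed.

HB.instance Definition _ :=
  Choice.copy (formula V) (pcan_type formula_codeK).

End FormulaChoice.

Section FormulaSem.
Context {V : choiceType}.

Fixpoint holds (s : V -> int) (f : formula V) : bool :=
  match f with
  | Atom p q => peval s p < peval s q
  | And f g => holds s f && holds s g
  | Or f g => holds s f || holds s g
  end.

Definition valid_imp (f g : formula V) : Prop :=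
  forall s : V -> int, holds s f -> holds s g.

Fixpoint fsubst {W : choiceType} (th : V -> mpol int W) (f : formula V) :
    formula W :=
  match f with
  | Atom p q => Atom (psubst th p) (psubst th q)
  | And f g => And (fsubst th f) (fsubst th g)
  | Or f g => Or (fsubst th f) (fsubst th g)
  end.

Fixpoint atoms (f : formula V) : seq (atom V) :=
  match f with
  | Atom p q => [:: (p, q)]
  | And f g | Or f g => atoms f ++ atoms g
  end.

End FormulaSem.

Section Programs.
Variable V : choiceType.

Definition transition (PV : {fset V}) (L : finType) : choiceType :=
  (L * formula V * {ffun PV -> mpol int V} * L)%type.

Definition src {PV : {fset V}} {L : finType} (t : transition PV L) : L :=
  t.1.1.1.
Definition guard {PV : {fset V}} {L : finType} (t : transition PV L) :
  formula V := t.1.1.2.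
Definition update {PV : {fset V}} {L : finType} (t : transition PV L) :
  {ffun PV -> mpol int V} := t.1.2.
Definition tgt {PV : {fset V}} {L : finType} (t : transition PV L) : L := t.2.

Record program := Program {
  pvars : {fset V};
  loc : finType;
  init : loc;
  trans : {fset transition pvars loc};
  tgt_init : forall t, t \in trans -> tgt t != init
}.

Definition config (P : program) : Type := (loc P * (V -> int))%type.

(* Variables outside [pvars P] get arbitrary new values. *)
Definition step (P : program) (t : transition (pvars P) (loc P))
    (c c' : config P) : Prop :=
  [/\ c.1 = src t, c'.1 = tgt t, holds c.2 (guard t)
    & forall v : pvars P, c'.2 (val v) = peval c.2 (update t v)].

Definition step_in (P : program) (T : {fset transition (pvars P) (loc P)})
    (c c' : config P) : Prop :=
  exists2 t, t \in T & step t c c'.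

End Programs.

Arguments tgt_init {V} p t.

Definition star {A : Type} (R : A -> A -> Prop) : A -> A -> Prop :=
  clos_refl_trans A R.

(* [rcomp R S] performs R first, then S. *)
Definition rcomp {A : Type} (R S : A -> A -> Prop) (a c : A) : Prop :=
  exists2 b, R a b & S b c.

Fixpoint rpow {A : Type} (R : A -> A -> Prop) (k : nat) : A -> A -> Prop :=
  if k is k'.+1 then rcomp R (rpow R k') else @eq A.

Definition infinite_evaluation {V : choiceType} (P : program V)
    (f : nat -> config P) : Prop :=
  (f 0%N).1 = init P /\ forall n, step_in (trans P) (f n) (f n.+1).

Definition terminating {V : choiceType} (P : program V) : Prop :=
  ~ exists f : nat -> config P, infinite_evaluation f.

Inductive bound {V : choiceType} (PV : {fset V}) : Type :=
| BConst of nat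
| BOmega
| BVar of PV
| BAdd of bound PV & bound PV
| BMul of bound PV & bound PV
| BExp of nat & bound PV.

Arguments BConst {V PV}.
Arguments BOmega {V PV}.
Arguments BVar {V PV}.

(* Values in N + {omega}, with [None] as omega *)
Definition omega_le (a b : option nat) : bool :=
  match a, b with
  | _, None => true
  | None, Some _ => false
  | Some m, Some n => (m <= n)%N
  end.

Definition omega_add (a b : option nat) : option nat :=
  if (a, b) is (Some m, Some n) then Some (m + n)%N else None.

(* Convention 0 * omega = 0. *)
Definition omega_mul (a b : option nat) : option nat :=
  match a, b with
  | Some m, Some n => Some (m * n)%N
  | Some 0, _ | _, Some 0 => Some 0%N
  | _, _ => None
  end.

(* Conventions 0 ^ omega = 0, 1 ^ omega = 1, and omega for larger bases. *)
Definition omega_exp (k : nat) (a : option nat) : option nat :=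
  match a with
  | Some n => Some (k ^ n)%N
  | None => if (k <= 1)%N then Some k else None
  end.

Fixpoint beval {V : choiceType} {PV : {fset V}} (s : V -> nat) (b : bound PV) :
    option nat :=
  match b with
  | BConst n => Some n
  | BOmega => None
  | BVar v => Some (s (val v))
  | BAdd b1 b2 => omega_add (beval s b1) (beval s b2)
  | BMul b1 b2 => omega_mul (beval s b1) (beval s b2)
  | BExp k b => omega_exp k (beval s b)
  end.

Definition abs_state {V : Type} (s : V -> int) : V -> nat :=
  fun v => `|s v|%N.

Definition is_sup (A : nat -> Prop) (S : option nat) : Prop :=
  (forall k, A k -> omega_le (Some k) S) /\
  (forall U, (forall k, A k -> omega_le (Some k) U) -> omega_le S U).

Section LocalBounds.
Context {V : choiceType} (P : program V).
Implicit Types r s : transition (pvars P) (loc P).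

Definition entries (T' : {fset transition (pvars P) (loc P)}) :
  {fset transition (pvars P) (loc P)} :=
  [fset r in trans P `\` T' | has (fun t => tgt r == src t) T'].

Definition reach_via r : config P -> config P -> Prop :=
  rcomp (star (step_in (trans P))) (step r).

Definition local_runs (T' : {fset transition (pvars P) (loc P)}) s r
    (sg : V -> int) (k : nat) : Prop :=
  exists (sg0 : V -> int) (l'' : loc P) (c' : config P),
    reach_via r (init P, sg0) (l'', sg) /\
    rpow (rcomp (star (step_in T')) (step s)) k (l'', sg) c'.

Definition local_runtime_bound (Tgt T' : {fset transition (pvars P) (loc P)})
    (RB : entries T' -> bound (pvars P)) : Prop :=
  forall s, s \in Tgt -> forall (r : entries T') (sg : V -> int),
  exists2 S, is_sup (local_runs T' s (val r) sg) S
           & omega_le S (beval (abs_state sg) (RB r)).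

End LocalBounds.

Arguments local_runtime_bound {V P} Tgt T' RB.

(* Loops over x_1, ..., x_d, with x_(i+1) encoded as i : 'I_d *)

Record loop (d : nat) := Loop {
  lpre : formula 'I_d;
  lguard : formula 'I_d;
  lupd : 'I_d -> mpol int 'I_d
}.

Section Loops.
Variable d : nat.
Implicit Types L : loop d.

Definition triangular (C : int -> Prop) (eta : 'I_d -> mpol int 'I_d) : Prop :=
  forall i, exists (c : int) (p : mpol int 'I_d),
    [/\ C c, eta i = c *: pvar i + p
      & forall m, m \in msupp p -> forall j, j \in finsupp m -> (i < j)%N].

Definition is_twn L : Prop :=
  valid_imp (lpre L) (fsubst (lupd L) (lpre L)) /\
  triangular (fun=> True) (lupd L).

Definition is_tnn L : Prop :=
  valid_imp (lpre L) (fsubst (lupd L) (lpre L)) /\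
  triangular (fun c => 0 <= c) (lupd L).

(* Locations: [false] is the initial one, [true] the loop head. *)
Definition loop_vars : {fset 'I_d} := [fset i | i in 'I_d].

Definition loop_entry L : transition loop_vars bool :=
  (false, lpre L, [ffun v : loop_vars => pvar (val v)], true).

Definition loop_body L : transition loop_vars bool :=
  (true, lguard L, [ffun v : loop_vars => lupd L (val v)], true).

Lemma loop_tgt_init L t :
  t \in [fset loop_entry L; loop_body L] -> tgt t != false.
Proof. by rewrite !inE => /orP[] /eqP->. Qed.

Definition loop_program L : program 'I_d := Program (@loop_tgt_init L).

Definition loop_star L : loop d :=
  Loop (lpre L) (And (lguard L) (fsubst (lupd L) (lguard L)))
       (fun i => psubst (lupd L) (lupd L i)).

End Loops.

(* The pair (b, a) stands for n^a * b^n. *)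
Definition powexp : Type := (nat * nat)%type.

HB.instance Definition _ := Choice.on powexp.

Definition powexp1 : powexp := (1, 0)%N.
Definition powexpM (u v : powexp) : powexp := (u.1 * v.1, u.2 + v.2)%N.

Lemma powexpMA : associative powexpM.
Proof. by move=> u v w; rewrite /powexpM /= mulnA addnA. Qed.
Lemma powexp1M : left_id powexp1 powexpM.
Proof. by case=> b a; rewrite /powexpM /= mul1n add0n. Qed.
Lemma powexpM1 : right_id powexp1 powexpM.
Proof. by case=> b a; rewrite /powexpM /= muln1 addn0. Qed.
Lemma powexp_unit u v :
  powexpM u v = powexp1 -> u = powexp1 /\ v = powexp1.
Proof.
case: u v => [b a] [b' a'] [/eqP]; rewrite muln_eq1 => /andP[/eqP-> /eqP->].
by move/eqP; rewrite addn_eq0 => /andP[/eqP-> /eqP->].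
Qed.
Lemma powexpMC : commutative powexpM.
Proof. by move=> u v; rewrite /powexpM mulnC addnC. Qed.

HB.instance Definition _ := Choice_isMonomialDef.Build powexp
  powexpMA powexp1M powexpM1 powexp_unit.
HB.instance Definition _ := MonomialDef_isConomialDef.Build powexp powexpMC.

Definition lex_gt (u v : powexp) : bool :=
  (v.1 < u.1)%N || (u.1 == v.1) && (v.2 < u.2)%N.
Definition lex_le (u v : powexp) : bool := ~~ lex_gt u v.
Definition growth (u : powexp) (n : nat) : nat := (n ^ u.2 * u.1 ^ n)%N.

(* Sums of p * n^a * b^n with p in R[x_1, ..., x_d] *)
Notation pexpr R d := {malg (mpol R 'I_d)[powexp]}.

Section PolyExp.
Variable d : nat.

Definition pexpr_eval {R : comNzRingType} (e : 'I_d -> R) (n : nat)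
    (P : pexpr R d) : R :=
  mmap (peval e) (fun u => (growth u n)%:R) P.

Definition closed_form (eta : 'I_d -> mpol int 'I_d) (n0 : nat)
    (cl : 'I_d -> pexpr rat d) : Prop :=
  (forall i u, u \in msupp (cl i) -> (1 <= u.1)%N) /\
  forall i (e : 'I_d -> int) n, (n0 <= n)%N ->
    pexpr_eval (fun j => (e j)%:~R) n (cl i) =
    (peval e (iter n (psubst eta) (pvar i)))%:~R.

Definition cl_subst (cl : 'I_d -> pexpr rat d) (p : mpol int 'I_d) :
    pexpr rat d :=
  mmap (fun c : int => c%:~R) (moneval cl) p.

Definition denom_lcm (P : pexpr rat d) : nat :=
  \big[lcmn/1%N]_(u <- msupp P)
    \big[lcmn/1%N]_(m <- msupp (mcoeff u P)) `|denq (mcoeff m (mcoeff u P))|%N.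

Definition pexpr_ratr (P : pexpr int d) : pexpr rat d :=
  mmap (fun p : mpol int 'I_d => (mmap (fun c : int => (c%:~R)%:MP)
                                     (fun m => << m >>) p)%:MP)
       (fun u => << u >>) P.

Definition is_npe (cl : 'I_d -> pexpr rat d) (al : atom 'I_d)
    (npe : pexpr int d) : Prop :=
  let Q := cl_subst cl (al.2 - al.1) in
  pexpr_ratr npe = Q *+ denom_lcm Q.

End PolyExp.

(* Relational because thresholds need not exist: if u and v both have base 0,
   u never strictly dominates v for large n, although [lex_gt u v] may hold. *)
Definition mono_thr (k : nat) (u v : powexp) (n0 : nat) : Prop :=
  let P m := forall n, (m <= n)%N -> (k * growth v n < growth u n)%N in
  [/\ lex_gt u v, P n0 & forall m, P m -> (n0 <= m)%N].

Definition max_mono_thr (k : nat) (uvs : seq (powexp * powexp)) (m : nat) :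
    Prop :=
  exists2 ts : seq nat,
    List.Forall2 (fun uv t => mono_thr k uv.1 uv.2 t) uvs ts
    & m = \max_(t <- ts) t.

Section Stabilization.
Variable d : nat.

Definition is_monomial (p : mpol int 'I_d) : Prop :=
  exists (c : int) (m : {cmonom 'I_d}), c != 0 /\ p = << c *g m >>.

(* [bar] is an over-approximation of [npe] with threshold [D], for the
   strengthened precondition [psi']. Elements of [Lam] are pairs (p, (b, a)),
   and [ji] maps them to the new pair (j, i). *)
Definition over_approx (psi' : formula 'I_d) (npe bar : pexpr int d) (D : nat) :
    Prop :=
  exists (Lam Del Gam : {fset mpol int 'I_d * powexp})
         (ji : mpol int 'I_d * powexp -> powexp),
  [/\ (forall w, w \in Lam -> is_monomial w.1) /\
        npe = \sum_(w <- Lam) << w.1 *g w.2 >>,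
      [/\ Del `<=` Lam, Gam `<=` Lam & [disjoint Del & Gam]],
      (forall w, w \in Del -> lex_gt (ji w) w.2 /\
         forall e : 'I_d -> int, holds e psi' -> 0 < peval e w.1) /\
      (forall w, w \in Gam -> lex_gt w.2 (ji w) /\
         forall e : 'I_d -> int, holds e psi' -> peval e w.1 <= 0),
      bar = \sum_(w <- Del `|` Gam) << w.1 *g ji w >> +
            \sum_(w <- Lam `\` (Del `|` Gam)) << w.1 *g w.2 >> /\
      (bar != npe -> forall e : 'I_d -> int, holds e psi' ->
         exists N, forall n, (N <= n)%N -> pexpr_eval e n bar <= 0)
    & max_mono_thr 1 ([seq (ji w, w.2) | w <- Del] ++
                      [seq (w.2, ji w) | w <- Gam]) D].

(* The increasing sequence (b_1, a_1), ..., (b_l, a_l) of [bar] *)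
Definition keys (bar : pexpr int d) : seq powexp := sort lex_le (msupp bar).

(* 1-based access *)
Definition key (ks : seq powexp) (j : nat) : powexp := nth powexp1 ks j.-1.

Definition is_M (ks : seq powexp) (j m : nat) : Prop :=
  let u := key ks j in
  let v := key ks j.-1 in
  if u.1 == v.1 then m = 0%N else mono_thr 1 u (v.1, v.2.+1) m.

Definition is_N (ks : seq powexp) (j m : nat) : Prop :=
  if j == 2%N then m = 1%N
  else exists2 mt', mono_thr (j - 2) (key ks (j - 1)) (key ks (j - 2)) mt' &
       if j == 3%N then m = mt'
       else exists2 mt,
         max_mono_thr 1
           [seq (key ks (j - 2), key ks i) | i <- iota 1 (j - 3)] mt
         & m = maxn mt mt'.

Definition is_C (bar : pexpr int d) (C : nat) : Prop :=
  let ks := keys bar in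
  exists M N : nat -> nat,
    (forall j, (2 <= j <= size ks)%N -> is_N ks j (N j) /\ is_M ks j (M j)) /\
    C = maxn 1 (\max_(2 <= j < (size ks).+1) maxn (N j) (M j)).

(* p_1, ..., p_(l-1) *)
Definition lower_coeffs (bar : pexpr int d) : seq (mpol int 'I_d) :=
  [seq mcoeff u bar | u <- take (size (keys bar)).-1 (keys bar)].

Definition sqcup (qs : seq (mpol int 'I_d)) : mpol int 'I_d :=
  \sum_(m <- undup (flatten [seq enum_fset (msupp q) | q <- qs]))
    << (\max_(q <- qs) `|mcoeff m q|%N)%:Z *g m >>.

Definition stab_bound_poly (L : loop d) (q : mpol int 'I_d) : Prop :=
  exists (n0 : nat) (cl : 'I_d -> pexpr rat d)
         (bar : atom 'I_d -> pexpr int d)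
         (C D : atom 'I_d -> nat),
  let As := atoms (lguard L) in
  [/\ closed_form (lupd L) n0 cl,
      forall al, al \in As -> exists npe,
        [/\ is_npe cl al npe,
            over_approx (And (lpre L) (lguard L)) npe (bar al) (D al)
          & is_C (bar al) (C al)]
    & q = sqcup (flatten [seq lower_coeffs (bar al) | al <- As]) *+ 2 +
          (maxn n0 (maxn (\max_(al <- As) C al) (\max_(al <- As) D al)))%:R].

End Stabilization.

Section BoundOfPoly.
Context {V : choiceType} {PV : {fset V}} {d : nat} (x : 'I_d -> PV).

(* Meant for polynomials with natural coefficients. *)
Definition bound_of_poly (q : mpol int 'I_d) : bound PV :=
  \big[@BAdd V PV/BConst 0]_(m <- msupp q)
    BMul (BConst `|mcoeff m q|%N)
         (\big[@BMul V PV/BConst 1]_(i <- finsupp m)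
            iter (m i) (BMul (BVar (x i))) (BConst 1)).

Definition loop_bound (L : loop d) (b : bound PV) : Prop :=
  let term := terminating (loop_program L) in
  [\/ [/\ is_tnn L, term
        & exists2 q, stab_bound_poly L q & b = bound_of_poly q],
      [/\ is_twn L, ~ is_tnn L, term
        & exists2 q, stab_bound_poly (loop_star L) q
          & b = BAdd (BMul (BConst 2) (bound_of_poly q)) (BConst 1)]
    | ~ (is_twn L /\ term) /\ b = BOmega].

(* The inclusion Z[x_1, ..., x_d] -> Z[V] *)
Definition incl (i : 'I_d) : mpol int V := pvar (val (x i)).

End BoundOfPoly.

(* Main.v *)
Require Import Defs.
From Stdlib Require Import Classical.
From HB Require Import structures.
From mathcomp Require Import all_boot all_order all_algebra.
From mathcomp Require Import finmap.
From mathcomp Require Import monalg.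
From mathcomp Require Import zify.

Set Implicit Arguments.
Unset Strict Implicit.
Unset Printing Implicit Defensive.

Import Order.TTheory GRing.Theory Num.Theory.

Local Open Scope fset_scope.
Local Open Scope ring_scope.

(* Let e be a start value satisfying psi, and suppose that the guard of a loop
   holds during more than sth(|e|) iterations, say still in iteration N with
   N >= sth(|e|). For an atom s1 < s2 true in iteration N, npe and hence its
   over-approximation is positive at N. Since N >= max(C, 2 * (sup Pol)(|e|)),
   the sign of the over-approximation at any n >= N is that of its largest
   nonvanishing coefficient: the terms below it sum to less than
   2 * (sup Pol)(|e|) times the next lower growth rate, which is at most the
   dominant growth rate. So the over-approximation stays positive; it cannot be
   eventually nonpositive, hence equals npe, and the atom stays true. As
   formulas are monotone in their atoms, the guard holds forever from N on, and
   invariance of psi yields an infinite evaluation. For twn-loops the argument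
   applied to L * L bounds half of the number of iterations. *)

(** * Evaluation of polynomials and formulas *)

(** Variables outside the support have exponent 0. With the larger index set, two monomials and
    their product can be evaluated over the same variables. *)
Lemma monevalEw (V : choiceType) (S : comNzRingType) (h : V -> S)
    (m : {cmonom V}) (D : {fset V}) :
  finsupp m `<=` D -> moneval h m = \prod_(v <- D) h v ^+ m v.
Proof.
move=> mD; rewrite /moneval; apply: big_fset_incl => // v _ vm.
by rewrite (fsfun_dflt vm).
Qed.

Lemma moneval_is_mmorphism (V : choiceType) (S : comNzRingType) (h : V -> S) :
  mmorphism (moneval h).
Proof.
split=> [m1 m2|]; last by rewrite /moneval mdom1 big_seq_fset0.
rewrite (@monevalEw _ _ h (mmul m1 m2) (finsupp m1 `|` finsupp m2)) ?mdomD //.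
rewrite (monevalEw h (fsubsetUl (finsupp m1) (finsupp m2))).
rewrite (monevalEw h (fsubsetUr (finsupp m1) (finsupp m2))).
by rewrite -big_split /=; apply: eq_bigr => v _; rewrite cmM exprD.
Qed.

HB.instance Definition _ (V : choiceType) (S : comNzRingType) (h : V -> S) :=
  isMultiplicative.Build {cmonom V} S (moneval h) (moneval_is_mmorphism h).

Definition growthr (R : comNzRingType) n (u : powexp) : R := (growth u n)%:R.

Lemma growthr_is_mmorphism (R : comNzRingType) n : mmorphism (growthr R n).
Proof.
split=> [[b a] [b' a']|]; last by rewrite /growthr /growth /= expn0 exp1n.
by rewrite /growthr -natrM /growth /= expnD expnMn mulnACA.
Qed.

HB.instance Definition _ (R : comNzRingType) n :=
  isMultiplicative.Build powexp R (growthr R n) (growthr_is_mmorphism R n).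

(* Ring morphisms out of monoid algebras are bundled over the [comNzRingType]
   structure: unifying the structures of nested algebras along different
   inheritance paths diverges. *)
Definition malgr (K : conomType) (R : comNzRingType) : comNzRingType :=
  {malg R[K]}.

Definition mmapr (K : conomType) (R S : comNzRingType)
    (f : {rmorphism R -> S}) (h : {mmorphism K -> S}) :
  {rmorphism malgr K R -> S} := mmap f h.

Definition pevalr (V : choiceType) (R : comNzRingType) (s : V -> R) :
  {rmorphism malgr {cmonom V} R -> R} := mmapr idfun (moneval s).

Definition pexpr_evalr d (R : comNzRingType) (e : 'I_d -> R) n :
    {rmorphism malgr powexp (malgr {cmonom 'I_d} R) -> R} :=
  mmapr (pevalr e) (growthr R n).

Lemma rmorph_moneval (V : choiceType) (S T : comNzRingType)
    (f : {rmorphism S -> T}) (s : V -> S) m :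
  f (moneval s m) = moneval (f \o s) m.
Proof. by rewrite rmorph_prod; apply: eq_bigr => v _; rewrite rmorphXn. Qed.

Lemma pevalE (V : choiceType) (S : comNzRingType) (s : V -> S) p :
  peval s p = \sum_(m <- msupp p) mcoeff m p * moneval s m.
Proof. by []. Qed.

Lemma pevalU (V : choiceType) (S : comNzRingType) (s : V -> S) c m :
  peval s << c *g m >> = c * moneval s m.
Proof. exact: mmapU. Qed.

Lemma peval_var (V : choiceType) (S : comNzRingType) (s : V -> S) v :
  peval s (pvar v) = s v.
Proof.
by rewrite pevalU mul1r /moneval mdomU big_seq_fset1 cmUU expr1.
Qed.

Lemma eq_moneval (V : choiceType) (S : comNzRingType) (s s' : V -> S) :
  s =1 s' -> moneval s =1 moneval s'.
Proof. by move=> ss m; apply: eq_bigr => v _; rewrite ss. Qed.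

Lemma eq_peval (V : choiceType) (S : comNzRingType) (s s' : V -> S) :
  s =1 s' -> peval s =1 peval s'.
Proof. by move=> ss p; apply: eq_bigr => m _; rewrite (eq_moneval ss). Qed.

Lemma rmorph_peval (V : choiceType) (S T : comNzRingType)
    (f : {rmorphism S -> T}) (s : V -> S) p :
  f (peval s p) = \sum_(m <- msupp p) f (mcoeff m p) * moneval (f \o s) m.
Proof.
rewrite pevalE rmorph_sum; apply: eq_bigr => m _.
by rewrite rmorphM rmorph_moneval.
Qed.

Lemma rmorph_mmap (V : choiceType) (A R S : comNzRingType)
    (f : {rmorphism R -> S}) (c : A -> R) (g : V -> R) (p : mpol A V) :
  f (mmap c (moneval g) p) =
  \sum_(m <- msupp p) f (c (mcoeff m p)) * moneval (f \o g) m.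
Proof.
rewrite mmapE rmorph_sum; apply: eq_bigr => m _.
by rewrite rmorphM rmorph_moneval.
Qed.

Lemma peval_psubst (V W : choiceType) (th : V -> mpol int W) (s : W -> int) p :
  peval s (psubst th p) = peval (fun v => peval s (th v)) p :> int.
Proof.
have := rmorph_mmap (pevalr s) (fun c : int => c%:MP) th p.
move=> E; apply: etrans E _.
apply: eq_bigr => m _; congr (_ * _).
by apply: etrans (pevalU s _ _) _; rewrite mmorph1 mulr1.
Qed.

Lemma holds_psubst (V W : choiceType) (th : V -> mpol int W) (s : W -> int) f :
  holds s (fsubst th f) = holds (fun v => peval s (th v)) f.
Proof.
elim: f => [p q|f IHf g IHg|f IHf g IHg].
- by rewrite /=; rewrite -> (peval_psubst th s p), (peval_psubst th s q).
- by rewrite /= IHf IHg.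
- by rewrite /= IHf IHg.
Qed.

Lemma holds_ext (V : choiceType) (s s' : V -> int) :
  s =1 s' -> holds s =1 holds s'.
Proof.
move=> ss; elim=> [p q|f IHf g IHg|f IHf g IHg].
- have ssE r : peval s r = peval s' r :> int by exact: eq_peval.
  by rewrite /=; rewrite -> (ssE p), (ssE q).
- by rewrite /= IHf IHg.
- by rewrite /= IHf IHg.
Qed.

Lemma holds_mono (V : choiceType) (s s' : V -> int) f :
    (forall al, al \in atoms f ->
       peval s al.1 < peval s al.2 -> peval s' al.1 < peval s' al.2) ->
  holds s f -> holds s' f.
Proof.
elim: f => [p q|f IHf g IHg|f IHf g IHg] mono.
- exact: mono (p, q) (mem_head _ _).
- case/andP=> sf sg; apply/andP; split; [apply: IHf sf|apply: IHg sg];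
    by move=> al alA; apply: mono; rewrite mem_cat alA ?orbT.
- case/orP=> sfg; apply/orP; [left; apply: IHf sfg|right; apply: IHg sfg];
    by move=> al alA; apply: mono; rewrite mem_cat alA ?orbT.
Qed.

(** * Evaluation of poly-exponential expressions *)

Section PowerExpressions.
Variable d : nat.

Lemma pexpr_evalE (R : comNzRingType) (e : 'I_d -> R) n (p : pexpr R d) :
  pexpr_eval e n p = \sum_(u <- msupp p) peval e (mcoeff u p) * (growth u n)%:R.
Proof. by []. Qed.

Lemma pexpr_evalU (R : comNzRingType) (e : 'I_d -> R) n p u :
  pexpr_eval e n << p *g u >> = peval e p * (growth u n)%:R.
Proof. exact: (@mmapU _ _ _ (pevalr e)). Qed.

Lemma pexpr_eval_subst (e : 'I_d -> rat) n cl p :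
  pexpr_eval e n (cl_subst cl p) =
  \sum_(m <- msupp p) (mcoeff m p)%:~R * moneval (pexpr_eval e n \o cl) m.
Proof.
apply: etrans (rmorph_mmap (pexpr_evalr e n) (fun c : int => c%:~R) cl p) _.
by apply: eq_bigr => m _; congr (_ * _); exact: (rmorph_int (pexpr_evalr e n)).
Qed.

(** The coefficient map inside [pexpr_ratr], named so that its evaluation can be treated by
    itself. *)
Definition mpol_ratr (p : mpol int 'I_d) : mpol rat 'I_d :=
  mmap (fun c : int => (c%:~R)%:MP) (fun m => << m >>) p.

Lemma peval_ratr (e : 'I_d -> int) p :
  peval (fun i => (e i)%:~R : rat) (mpol_ratr p) = (peval e p)%:~R.
Proof.
have -> : (peval e p)%:~R =
  \sum_(m <- msupp p) (mcoeff m p)%:~R * moneval (fun i => (e i)%:~R : rat) m.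
  exact: (rmorph_peval (intr : {rmorphism int -> rat})).
apply: etrans (raddf_sum (pevalr (fun i => (e i)%:~R : rat)) _ _ _) _.
apply: eq_bigr => m _.
apply: etrans (rmorphM (pevalr (fun i => (e i)%:~R : rat)) _ _) _.
congr (_ * _); first by apply: etrans (pevalU _ _ _) _; rewrite mmorph1 mulr1.
by apply: etrans (pevalU _ _ _) _; rewrite mul1r.
Qed.

Lemma pexpr_eval_ratr (e : 'I_d -> int) n p :
  pexpr_eval (fun i => (e i)%:~R : rat) n (pexpr_ratr p) =
  (pexpr_eval e n p)%:~R.
Proof.
have -> : (pexpr_eval e n p)%:~R =
    \sum_(u <- msupp p) (peval e (mcoeff u p))%:~R * (growth u n)%:R :> rat.
  rewrite pexpr_evalE (raddf_sum (intr : {rmorphism int -> rat})).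
  by apply: eq_bigr => u _; rewrite /= intrM natz.
apply: etrans (raddf_sum (pexpr_evalr (fun i => (e i)%:~R : rat) n) _ _ _) _.
apply: eq_bigr => u _.
apply: etrans (rmorphM (pexpr_evalr (fun i => (e i)%:~R : rat) n) _ _) _.
congr (_ * _).
- apply: etrans (pexpr_evalU _ _ _ _) _.
  by rewrite -[RHS]mulr1; congr (_ * _);
    [exact: peval_ratr|rewrite /growth /= expn0 exp1n].
- apply: etrans (pexpr_evalU _ _ _ _) _; rewrite -[RHS]mul1r; congr (_ * _).
  exact: (rmorph1 (pevalr (fun i => (e i)%:~R : rat))).
Qed.

Lemma denom_lcm_gt0 (P : pexpr rat d) : (0 < denom_lcm P)%N.
Proof.
apply: (big_ind (fun k => 0 < k)%N) => // [a b a0 b0|u _].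
  by rewrite lcmn_gt0 a0.
apply: (big_ind (fun k => 0 < k)%N) => // [a b a0 b0|m _].
  by rewrite lcmn_gt0 a0.
by rewrite absz_gt0 denq_neq0.
Qed.

Definition run (eta : 'I_d -> mpol int 'I_d) (n : nat) (e : 'I_d -> int) :
  'I_d -> int := iter n (fun e i => peval e (eta i)) e.

Lemma run_add eta m n e : run eta (m + n) e = run eta m (run eta n e).
Proof. exact: iterD. Qed.

(** The outermost substitution acts as the first step on states, so the induction must generalize
    over [e]. *)
Lemma peval_iter_psubst eta n (e : 'I_d -> int) p :
  peval e (iter n (psubst eta) p) = peval (run eta n e) p :> int.
Proof.
elim: n e => // n IHn e; rewrite iterS; rewrite -> (peval_psubst eta e).
by rewrite -> IHn; rewrite /run iterSr.
Qed.

Lemma closed_form_eval eta n0 cl (e : 'I_d -> int) n p :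
    closed_form eta n0 cl -> (n0 <= n)%N ->
  pexpr_eval (fun i => (e i)%:~R) n (cl_subst cl p) =
  (peval (run eta n e) p)%:~R :> rat.
Proof.
move=> [_ cl_iter] n0n; rewrite pexpr_eval_subst.
have -> : (peval (run eta n e) p)%:~R = \sum_(m <- msupp p) (mcoeff m p)%:~R *
    moneval (fun i => (run eta n e i)%:~R : rat) m.
  exact: (rmorph_peval (intr : {rmorphism int -> rat})).
apply: eq_bigr => m _; congr (_ * _); apply: eq_moneval => i /=.
rewrite cl_iter //; congr (_%:~R).
by rewrite -> (peval_iter_psubst eta n e); exact: peval_var.
Qed.

(** By the closed form, [npe] at [n] is the difference of the two sides of the atom after [n]
    iterations, scaled by the positive lcm of the denominators. The comparison takes place in [rat],
    where the closed form lives. *)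
Lemma npe_gt0 eta n0 cl al npe (e : 'I_d -> int) n :
    closed_form eta n0 cl -> is_npe cl al npe -> (n0 <= n)%N ->
  (0 < pexpr_eval e n npe) =
  (peval (run eta n e) al.1 < peval (run eta n e) al.2).
Proof.
move=> clP npeP n0n.
pose Q := cl_subst cl (al.2 - al.1).
have E : (pexpr_eval e n npe)%:~R =
         (peval (run eta n e) al.2 - peval (run eta n e) al.1)%:~R
           *+ denom_lcm Q :> rat.
  rewrite -pexpr_eval_ratr npeP.
  apply: etrans (raddfMn (pexpr_evalr (fun i => (e i)%:~R : rat) n) _ _) _.
  congr (_ *+ _); apply: etrans (closed_form_eval e _ clP n0n) _.
  congr (_%:~R); exact: (raddfB (pevalr (run eta n e))).
rewrite -(ltr0z rat) E pmulrn_lgt0 ?denom_lcm_gt0 // ltr0z subr_gt0.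
by [].
Qed.

End PowerExpressions.

(** * Sign of the dominant term *)

Lemma lex_le_total : total lex_le.
Proof. by case=> [b a] [b' a']; rewrite /lex_le /lex_gt /=; lia. Qed.

Lemma lex_le_trans : transitive lex_le.
Proof.
by case=> [b a] [b' a'] [b'' a'']; rewrite /lex_le /lex_gt /=; lia.
Qed.

Lemma lex_le_neq_gt u v : lex_le u v -> u != v -> lex_gt v u.
Proof.
case: u v => [b a] [b' a']; rewrite /lex_le /lex_gt xpair_eqE /=; lia.
Qed.

Lemma max_mono_thrP k uvs m uv n :
    max_mono_thr k uvs m -> uv \in uvs -> (m <= n)%N ->
  (k * growth uv.2 n < growth uv.1 n)%N.
Proof.
case=> ts uvts ->; elim: uvts => // uv' t uvs' ts' [_ thr _] _ IH.
rewrite inE big_cons geq_max => uvP /andP[tn tsn].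
by case/predU1P: uvP => [->|/IH]; [exact: thr|apply].
Qed.

Lemma is_CP d (bar : pexpr int d) C :
    is_C bar C -> (0 < C)%N /\
    exists M N : nat -> nat, forall j, (2 <= j <= size (keys bar))%N ->
      [/\ is_N (keys bar) j (N j), is_M (keys bar) j (M j),
          (N j <= C)%N & (M j <= C)%N].
Proof.
case=> M [N [NM ->]]; split; first by rewrite leq_max.
exists M, N => j jP; have [Nj Mj] := NM j jP.
have le : (maxn (N j) (M j) <= \max_(2 <= i < (size (keys bar)).+1)
    maxn (N i) (M i))%N.
  by apply: leq_bigmax_seq; rewrite ?mem_index_iota.
by split=> //; rewrite leq_max (leq_trans _ le) ?orbT // leq_max leqnn ?orbT.
Qed.

Section Dominance.
Variables (d : nat) (bar : pexpr int d) (C : nat).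
Hypothesis barC : is_C bar C.
Let ks := keys bar.
Let g i n := growth (nth powexp1 ks i) n.

Lemma keys_lex_gt i j : (i < j < size ks)%N ->
  lex_gt (nth powexp1 ks j) (nth powexp1 ks i).
Proof.
move=> /andP[ij js]; apply: lex_le_neq_gt.
  apply: (sorted_leq_nth lex_le_trans);
    rewrite ?inE ?(ltn_trans ij) ?(ltnW ij) //.
    by move=> u; case: u => b a; rewrite /lex_le /lex_gt /=; lia.
  exact: sort_sorted lex_le_total _.
rewrite nth_uniq ?(ltn_trans ij) ?ltn_eqF //.
by rewrite sort_uniq fset_uniq.
Qed.

(** If the bases agree, the exponent of [n] grows by at least 1. Otherwise the threshold M compares
    with a pair whose exponent was raised by 1, and this extra power is the factor [n]. *)
Lemma growth_key_succ j n : (0 < j < size ks)%N -> (C <= n)%N ->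
  (n * g j.-1 n <= g j n)%N.
Proof.
case: j => // j js Cn; have [C0 [M [N MN]]] := is_CP barC.
(* The thresholds count keys from 1: position [j.+1] of the list is key [j.+2]. *)
have [_ + _ MC] := MN j.+2 js.
rewrite /is_M /key /= -/ks.
have := @keys_lex_gt j j.+1; rewrite ltnSn => /(_ js).
rewrite /g; case: (nth _ _ j.+1) (nth _ _ j) => [b a] [b' a'] /= gt.
have n0 : (0 < n)%N by apply: leq_trans Cn.
case: eqVneq gt => [->|bb'] gt.
  move=> _; rewrite /growth /= mulnA -expnS leq_mul2r leq_pexp2l ?orbT //.
  by move: gt; rewrite /lex_gt /= ltnn eqxx.
case=> _ /(_ n (leq_trans MC Cn)) + _.
by rewrite mul1n /growth /= expnS mulnA => /ltnW.
Qed.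

(** The threshold N makes the top summand exceed the sum of all summands below it, so the whole sum
    is less than twice the top one. *)
Lemma sum_growth_lower j n : (0 < j < size ks)%N -> (C <= n)%N ->
  (\sum_(i < j) g i n < 2 * g j.-1 n)%N \/ (\sum_(i < j) g i n = 0)%N.
Proof.
case: j => // j js Cn; rewrite big_ord_recr /= mul2n -addnn.
case: j js => [|j] js.
  (* A single term is less than twice itself unless it vanishes; the second alternative arises
     here. *)
  rewrite big_ord0 add0n; case: (posnP (g 0%N n)) => [->|g0]; [by right|left].
  by rewrite -[X in (X < _)%N]addn0 ltn_add2l.
left; rewrite ltn_add2r big_ord_recr /=.
have [_ [M [N MN]]] := is_CP barC; have [+ _ NC _] := MN j.+3 js.
rewrite /is_N /key /= -/ks !subSS subn0 => -[mt' [_ mt'P _] mtE].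
have mt'n : (mt' <= n)%N.
  apply: leq_trans Cn; apply: leq_trans NC.
  by case: ifP mtE => _; [move=> ->|case=> mt _ ->; rewrite leq_maxr].
(* By [mt'], [j.+1] copies of [g j n] stay below the top term. One copy is the summand [j] itself;
   the other [j] copies cover the smaller summands, each at most [g j n] by [mt]. *)
apply: leq_ltn_trans (mt'P n mt'n); rewrite mulSn addnC leq_add2l.
case: j js mtE NC {mt'P} => [|j] js; first by rewrite big_ord0.
case=> mt mtP Nmt NC.
have mtn : (mt <= n)%N.
  by apply: leq_trans Cn; apply: leq_trans NC; rewrite Nmt leq_maxl.
rewrite -[X in (_ <= X * _)%N]card_ord -sum_nat_const; apply: leq_sum => i _.
have := @max_mono_thrP _ _ _ (key ks j.+2, key ks i.+1) n mtP.
rewrite mul1n => lt; apply/ltnW/lt => //.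
apply/mapP; exists i.+1; rewrite ?subSS ?subn0 //.
by rewrite mem_iota; case: i {lt} => i /= ij; lia.
Qed.

(** The sign is that of the coefficient at the largest key where [c] does not vanish: being an
    integer, it is at least 1 in absolute value, while all lower terms together stay below its
    growth rate. [S] bounds every coefficient but the last, which is never a lower term. *)
Lemma dominant_sign (c : powexp -> int) (S : nat) :
    (forall u, u \in take (size ks).-1 ks -> (`|c u| <= S)%N) ->
    forall n m, (maxn C (2 * S) <= n)%N -> (maxn C (2 * S) <= m)%N ->
  0 < \sum_(u <- ks) c u * (growth u n)%:R ->
  0 < \sum_(u <- ks) c u * (growth u m)%:R.
Proof.
move=> cS n m; rewrite !geq_max => /andP[Cn Sn] /andP[Cm Sm].
pose a i := c (nth powexp1 ks i).
have sumE k : \sum_(u <- ks) c u * (growth u k)%:R =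
    \sum_(i < size ks) a i * (g i k)%:Z.
  rewrite (big_nth powexp1) big_mkord.
  by apply: eq_bigr => i _; rewrite natz.
rewrite !sumE => {sumE}.
have aS i : (i.+1 < size ks)%N -> (`|a i| <= S)%N.
  move=> ilt; apply: cS; have ik : (i < (size ks).-1)%N by lia.
  rewrite -(nth_take powexp1 ik) mem_nth // size_take.
  by case: ifP => // _; exact: ltnW ilt.
have [/forallP/= a0|] := boolP [forall i : 'I_(size ks), a i == 0].
  by rewrite big1 ?ltxx // => i _; rewrite (eqP (a0 i)) mul0r.
rewrite negb_forall => /existsP[i0 ai0].
pose P i := (i < size ks)%N && (a i != 0).
have exP : exists i, P i by exists i0; rewrite /P ltn_ord.
have Pbound i : P i -> (i <= size ks)%N by case/andP=> /ltnW.
case: (ex_maxnP exP Pbound) => j /andP[js aj0] jmax {exP Pbound i0 ai0}.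
have split_sum k : \sum_(i < size ks) a i * (g i k)%:Z =
    \sum_(i < j) a i * (g i k)%:Z + a j * (g j k)%:Z.
  rewrite -(big_mkord xpredT (fun i => a i * (g i k)%:Z)).
  rewrite (big_cat_nat (n := j.+1)) //= big_nat_recr //= big_mkord.
  rewrite [X in _ + _ + X]big_nat_cond [X in _ + _ + X]big1 ?addr0 // => i.
  rewrite andbT => /andP[ji ilt].
  case: (eqVneq (a i) 0) => [->|ai]; first by rewrite mul0r.
  by have := jmax i; rewrite /P ilt ai => /(_ isT); rewrite leqNgt ji.
rewrite !split_sum => {split_sum}.
(* The dominant growth rate may vanish: [ji] is allowed to choose base 0. *)
have lower k : (C <= k)%N -> (2 * S <= k)%N ->
    (\sum_(i < j) `|a i| * g i k < g j k)%N \/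
    (g j k = 0)%N /\ (\sum_(i < j) `|a i| * g i k = 0)%N.
  move=> Ck Sk.
  have le : (\sum_(i < j) `|a i| * g i k <= S * \sum_(i < j) g i k)%N.
    rewrite big_distrr; apply: leq_sum => i _; rewrite leq_mul2r aS ?orbT //.
    by case: i => i /= ij; lia.
  have [j0|j_gt0] := posnP j.
    by rewrite j0 !big_ord0; case: (posnP (g 0%N k)) => [->|]; [right|left].
  have jP : (0 < j < size ks)%N by rewrite j_gt0.
  have gk := growth_key_succ jP Ck.
  have [gj0|gj] := posnP (g j k).
    right; split=> //; apply/eqP; rewrite -leqn0; apply: leq_trans le _.
    case: (sum_growth_lower jP Ck) => [|->]; last by rewrite muln0.
    have : (0 < k)%N by apply: leq_trans Ck; case: (is_CP barC).
    nia.
  left; apply: leq_ltn_trans le _.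
  case: (sum_growth_lower jP Ck) => [lt|->]; last by rewrite muln0.
  have [->|S0] := posnP S; first by rewrite mul0n.
  (* The coefficients cost a factor [S] and the sum a factor 2; both are absorbed by the factor [k]
     between neighbouring growth rates. *)
  apply: leq_trans gk; apply: leq_trans (_ : 2 * S * g j.-1 k <= _)%N.
    by rewrite (mulnC 2) -mulnA ltn_mul2l S0.
  by rewrite leq_mul2r Sk orbT.
have abs_sum k : `|\sum_(i < j) a i * (g i k)%:Z| <=
    (\sum_(i < j) `|a i| * g i k)%N%:Z.
  apply: le_trans (ler_norm_sum _ _ _) _.
  rewrite -natz natr_sum; apply: ler_sum => i _.
  by rewrite normrM natz PoszM abszE.
have [ltn|[gn sn]] := lower n Cn Sn; last first.
  have := abs_sum n; rewrite sn normr_le0 => /eqP->.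
  by rewrite gn mulr0 ltxx.
have gn0 : (0 < g j n)%N by apply: leq_ltn_trans ltn.
(* A growth rate that is nonzero at one positive point has a nonzero base, so it is nonzero at every
   positive point. *)
have gm0 : (0 < g j m)%N.
  have n0 : (0 < n)%N by apply: leq_trans Cn; case: (is_CP barC).
  have m0 : (0 < m)%N by apply: leq_trans Cm; case: (is_CP barC).
  move: gn0; rewrite /g /growth !muln_gt0 !expn_gt0 n0 m0 /=.
  by case/orP=> [->//|/eqP n00]; rewrite n00 in n0.
have [ltm|[gm _]] := lower m Cm Sm; last by rewrite gm in gm0.
move: (abs_sum n) (abs_sum m) aj0 ltn ltm gn0 gm0.
move: (\sum_(i < j) a i * _) (\sum_(i < j) a i * _) => x y.
move: (\sum_(i < j) _)%N (\sum_(i < j) _)%N (a j) (g j n) (g j m).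
move=> p q z u v xp yq z0 pu qv u0 v0 pos.
(* Here [z] is the leading coefficient, and [u], [v] are its growth rates at [n] and [m]. If
   [z <= -1], then [z * u <= - u], which outweighs the lower sum at [n]. *)
have zpos : 0 < z.
  rewrite ltNge; apply/negP => zle.
  have : z * u%:Z <= (-1) * u%:Z by rewrite ler_wpM2r //; lia.
  lia.
have : 1 * v%:Z <= z * v%:Z by rewrite ler_wpM2r.
lia.
Qed.

End Dominance.

(** * Stabilization bounds *)

(** Past the threshold, positive coefficients in [Del] get a larger growth rate and nonpositive ones
    in [Gam] a smaller one, so each change can only increase the value. *)
Lemma over_approx_le d (psi' : formula 'I_d) npe bar D (e : 'I_d -> int) n :
    over_approx psi' npe bar D -> holds e psi' -> (D <= n)%N ->
  pexpr_eval e n npe <= pexpr_eval e n bar.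
Proof.
case=> Lam [Del [Gam [ji []]]].
case=> _ -> [DelLam GamLam _] [DelP GamP] [-> _] thr ePsi Dn.
pose U := Del `|` Gam.
have ULam : U `<=` Lam by rewrite fsubUset DelLam.
pose w_eval (ba : powexp) (p : mpol int 'I_d) :=
  peval e p * (growth ba n)%:R : int.
have evalE (A : {fset mpol int 'I_d * powexp})
    (f : mpol int 'I_d * powexp -> powexp) :
    pexpr_eval e n (\sum_(w <- A) << w.1 *g f w >>) =
    \sum_(w <- A) w_eval (f w) w.1.
  apply: etrans (raddf_sum (pexpr_evalr e n) _ _ _) _.
  by apply: eq_bigr => w _; exact: pexpr_evalU.
rewrite (evalE Lam snd) (big_fsetID _ (mem U)) /=.
have -> : [fset w in Lam | w \in U] = U.
  apply/fsetP=> w; rewrite !inE /= andb_idl // => wU.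
  by apply: (fsubsetP ULam); rewrite inE.
have -> : [fset w in Lam | w \notin U] = Lam `\` U.
  by apply/fsetP=> w; rewrite !inE /= andbC.
rewrite [leRHS](_ : _ = \sum_(w <- U) w_eval (ji w) w.1 +
    \sum_(w <- Lam `\` U) w_eval w.2 w.1); last first.
  rewrite -(evalE U ji) -(evalE _ snd).
  exact: (raddfD (pexpr_evalr e n)).
rewrite lerD2r big_seq [leRHS]big_seq.
apply: ler_sum => w; rewrite in_fsetU /w_eval => /orP[wDel|wGam].
- have [_ /(_ _ ePsi)/ltW p0] := DelP w wDel; apply: ler_wpM2l => //.
  have wP : (ji w, w.2) \in [seq (ji w, w.2) | w <- Del] ++
      [seq (w.2, ji w) | w <- Gam].
    by rewrite mem_cat (map_f (fun w => (ji w, w.2))).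
  by have := max_mono_thrP thr wP Dn; rewrite mul1n ler_nat => /ltnW.
- have [_ /(_ _ ePsi) p0] := GamP w wGam; apply: ler_wnM2l => //.
  have wP : (w.2, ji w) \in [seq (ji w, w.2) | w <- Del] ++
      [seq (w.2, ji w) | w <- Gam].
    by rewrite mem_cat (map_f (fun w => (w.2, ji w))) ?orbT.
  by have := max_mono_thrP thr wP Dn; rewrite mul1n ler_nat => /ltnW.
Qed.

Lemma bar_gt0_stable d (e : 'I_d -> int) (bar : pexpr int d) C S n m :
    is_C bar C ->
    (forall p, p \in lower_coeffs bar -> (`|peval e p| <= S)%N) ->
    (maxn C (2 * S) <= n)%N -> (maxn C (2 * S) <= m)%N ->
  0 < pexpr_eval e n bar -> 0 < pexpr_eval e m bar.
Proof.
move=> barC barS nle mle.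
have evalE k : pexpr_eval e k bar =
    \sum_(u <- keys bar) peval e (mcoeff u bar) * (growth u k)%:R :> int.
  by rewrite pexpr_evalE; apply: perm_big; rewrite perm_sym perm_sort.
rewrite !evalE; apply: (dominant_sign barC) nle mle => u uP.
by apply: barS; apply: (map_f (fun u => mcoeff u bar)).
Qed.

(** * Polynomials at absolute values and their bound expressions *)

Lemma moneval_nat (V : choiceType) (s : V -> nat) m :
  moneval (fun v => (s v)%:Z) m = (\prod_(v <- finsupp m) s v ^ m v)%N%:Z.
Proof.
rewrite /moneval (big_morph Posz PoszM (erefl _)).
by apply: eq_bigr => v _; rewrite -!natz natrX.
Qed.

Lemma absz_moneval (V : choiceType) (e : V -> int) m :
  `|moneval e m|%N = (\prod_(v <- finsupp m) `|e v| ^ m v)%N.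
Proof.
rewrite /moneval (big_morph absz abszM (erefl _)).
by apply: eq_bigr => v _; rewrite abszX.
Qed.

Lemma absz_sum (I : Type) (r : seq I) (F : I -> int) :
  (`|(\sum_(i <- r) F i)%R| <= \sum_(i <- r) `|F i|)%N.
Proof.
elim: r => [|i r IH]; first by rewrite !big_nil.
rewrite !big_cons; move: (\sum_(j <- r) F j) (\sum_(j <- r) _)%N IH => x y.
lia.
Qed.

Section BoundPolynomial.
Variables (d : nat) (e : 'I_d -> int).
Let s i := `|e i|%:Z.

(** Triangle inequality, followed by comparing coefficients monomial by monomial. *)
Lemma peval_sqcup qs : exists2 B : nat, peval s (sqcup qs) = B%:Z
  & forall p, p \in qs -> (`|peval e p| <= B)%N.
Proof.
pose R := undup (flatten [seq enum_fset (msupp q) | q <- qs]).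
pose w (m : {cmonom _}) := (\prod_(i <- finsupp m) `|e i| ^ m i)%N.
exists (\sum_(m <- R) (\max_(q <- qs) `|mcoeff m q|) * w m)%N.
  apply: etrans (raddf_sum (pevalr s) _ _ _) _.
  rewrite (big_morph Posz PoszD (erefl _)); apply: eq_bigr => m _.
  by apply: etrans (pevalU s _ _) _; rewrite moneval_nat PoszM.
move=> p pqs; rewrite pevalE; apply: leq_trans (absz_sum _ _) _.
(* The sum over the support of [p] is reindexed as a restricted sum over the monomials of all of
   [qs]. *)
have -> : (\sum_(m <- msupp p) `|(mcoeff m p * moneval e m)%R| =
    \sum_(m <- R | m \in msupp p) `|mcoeff m p| * w m)%N.
  rewrite -[RHS]big_filter.
  rewrite (eq_bigr (fun m => `|mcoeff m p| * w m)%N) => [|m _]; last first.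
    by rewrite abszM absz_moneval.
  apply: perm_big; apply: uniq_perm;
    rewrite ?fset_uniq ?filter_uniq ?undup_uniq //.
  move=> m; rewrite mem_filter mem_undup andb_idr // => mp.
  apply/flattenP; exists (enum_fset (msupp p)) => //.
  exact: (map_f (fun q : mpol int _ => enum_fset (msupp q))) pqs.
rewrite [leqRHS](bigID (fun m => m \in msupp p)) /=.
apply: leq_trans (leq_addr _ _); apply: leq_sum => m _.
pose c (q : mpol int 'I_d) := `|mcoeff m q|%N.
by rewrite leq_mul2r orbC (@leq_bigmax_seq _ qs xpredT c p).
Qed.

End BoundPolynomial.

Lemma omega_mulE m n : omega_mul (Some m) (Some n) = Some (m * n)%N.
Proof. by case: m. Qed.

(** [bound_of_poly] takes absolute values of coefficients, which changes nothing for nonnegative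
    ones. It contains no omega, so all values on the way are finite. *)
Lemma nonneg_beval (V : choiceType) (PV : {fset V}) d (x : 'I_d -> PV)
    (q : mpol int 'I_d) (sg : V -> int) B :
    (forall m, 0 <= mcoeff m q) ->
    peval (fun i => `|sg (val (x i))|%:Z) q = B%:Z ->
  beval (abs_state sg) (bound_of_poly x q) = Some B.
Proof.
move=> q_ge0 qB; pose w i := `|sg (val (x i))|%N.
have sumE (I : Type) (r : seq I) (F : I -> bound PV) (G : I -> nat) :
    (forall i, beval (abs_state sg) (F i) = Some (G i)) ->
    beval (abs_state sg) (\big[@BAdd V PV/BConst 0]_(i <- r) F i) =
    Some (\sum_(i <- r) G i)%N.
  move=> FG; elim: r => [|i r IH]; first by rewrite !big_nil.
  by rewrite !big_cons /= FG IH.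
have prodE (I : Type) (r : seq I) (F : I -> bound PV) (G : I -> nat) :
    (forall i, beval (abs_state sg) (F i) = Some (G i)) ->
    beval (abs_state sg) (\big[@BMul V PV/BConst 1]_(i <- r) F i) =
    Some (\prod_(i <- r) G i)%N.
  move=> FG; elim: r => [|i r IH]; first by rewrite !big_nil.
  by rewrite !big_cons /= FG IH omega_mulE.
have powE i k : beval (abs_state sg) (iter k (BMul (BVar (x i))) (BConst 1)) =
    Some (w i ^ k)%N.
  elim: k => // k IH; rewrite expnS -omega_mulE -IH.
  by [].
rewrite (sumE _ _ _
  (fun m => `|mcoeff m q| * \prod_(i <- finsupp m) w i ^ m i)%N).
  congr Some; apply/eqP; rewrite -eqz_nat -qB; apply/eqP.
  rewrite (big_morph Posz PoszD (erefl _)); apply: eq_bigr => m _.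
  rewrite PoszM abszE ger0_norm //; congr (_ * _).
  by apply/esym; exact: moneval_nat w m.
by move=> m; rewrite -omega_mulE /= (prodE _ _ _ (fun i => w i ^ m i)%N).
Qed.

Lemma sqcup_coeff_ge0 d (qs : seq (mpol int 'I_d)) m : 0 <= mcoeff m (sqcup qs).
Proof.
rewrite raddf_sum; apply: sumr_ge0 => m' _.
by rewrite /= mcoeffU mulrn_wge0.
Qed.

Section LoopBound.
Variables (d : nat) (L : loop d) (q : mpol int 'I_d).
Hypothesis qP : stab_bound_poly L q.

Lemma stab_bound_coeff_ge0 m : 0 <= mcoeff m q.
Proof.
case: qP => n0 [cl [bar [C [D [_ _ ->]]]]].
rewrite mcoeffD mcoeffMn mcoeffMn mcoeff1 addr_ge0 // mulrn_wge0 //.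
exact: sqcup_coeff_ge0.
Qed.

Hypothesis pre_inv : valid_imp (lpre L) (fsubst (lupd L) (lpre L)).

Lemma pre_run e n : holds e (lpre L) -> holds (run (lupd L) n e) (lpre L).
Proof.
elim: n => // n IHn /IHn/pre_inv.
by rewrite holds_psubst.
Qed.

(** Termination phrased through [run], so that for [loop_star L] it can be derived from termination
    of [L]. *)
Hypothesis no_run : forall e, holds e (lpre L) ->
  ~ (forall n, holds (run (lupd L) n e) (lguard L)).

Lemma stab_bound_run e : holds e (lpre L) ->
  exists2 B : nat, peval (fun i => `|e i|%:Z) q = B%:Z
    & forall k, (forall n, (n < k)%N -> holds (run (lupd L) n e) (lguard L)) ->
      (k <= B)%N.
Proof.
case: qP => n0 [cl [bar [C [D [clP barP ->]]]]] pre_e.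
set Pol := flatten _; set K := maxn n0 _.
have [B sqB PolB] := peval_sqcup e Pol.
exists (2 * B + K)%N.
  apply: etrans (raddfD (pevalr _) _ _) _; rewrite PoszD; congr (_ + _).
    apply: etrans (raddfMn (pevalr _) _ _) _.
    apply: etrans (congr1 (fun z : int => z *+ 2) sqB) _.
    by rewrite mul2n -addnn.
  by apply: etrans (rmorph_nat (pevalr _) _) _; rewrite natz.
move=> [//|N] guardN; rewrite leqNgt; apply/negP => NB.
(* Iterations count from 0: if [N.+1] guarded iterations exceed the bound, the last one, [N], has
   reached it. *)
have {}NB : (2 * B + K <= N)%N by rewrite -ltnS.
have gN := guardN N (ltnSn N).
apply: (no_run (pre_run N pre_e)) => n; rewrite -run_add.
apply: holds_mono gN => al alA; have [npe [npeP apx barC]] := barP al alA.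
have n0K : (n0 <= K)%N by rewrite leq_maxl.
have CK : (C al <= K)%N.
  rewrite !leq_max; apply/orP; right; apply/orP; left.
  exact: (@leq_bigmax_seq _ (atoms (lguard L)) xpredT C al).
have DK : (D al <= K)%N.
  rewrite !leq_max; apply/orP; right; apply/orP; right.
  exact: (@leq_bigmax_seq _ (atoms (lguard L)) xpredT D al).
have KN : (K <= N)%N by apply: leq_trans NB; rewrite leq_addl.
have NnN : (N <= n + N)%N by rewrite leq_addl.
rewrite -(npe_gt0 _ clP npeP) ?(leq_trans n0K) //.
rewrite -(npe_gt0 _ clP npeP) ?(leq_trans n0K) ?(leq_trans KN) //.
move=> npeN.
(* The over-approximation presupposes the guard at the start value as well; iteration 0 provides
   it. *)
have psi'e : holds e (And (lpre L) (lguard L)).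
  by rewrite /= pre_e; apply: (guardN 0%N).
have barN : 0 < pexpr_eval e N (bar al).
  by apply: lt_le_trans npeN (over_approx_le apx psi'e _); apply: leq_trans KN.
have bar_pos k : (N <= k)%N -> 0 < pexpr_eval e k (bar al).
  move=> Nk; apply: (bar_gt0_stable (n := N) barC (S := B)) barN.
  - by move=> p pP; apply: PolB; apply/flattenP;
      exists (lower_coeffs (bar al)) => //; apply: map_f.
  - rewrite geq_max (leq_trans CK) //=; move: NB; lia.
  - rewrite geq_max (leq_trans CK) ?(leq_trans KN) //=; move: NB Nk; lia.
have [<-|bar_npe] := eqVneq (bar al) npe; first exact: bar_pos.
case: apx => Lam [Del [Gam [ji [_ _ _ [_ ev] _]]]].
have [N' N'P] := ev bar_npe e psi'e.
(* At this point [bar al] would be both positive and nonpositive. *)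
have := N'P (maxn N N') (leq_maxr _ _).
by rewrite leNgt bar_pos // leq_maxl.
Qed.

End LoopBound.

(** * Runs of loops and programs *)

Lemma eq_run d (eta : 'I_d -> mpol int 'I_d) n (e e' : 'I_d -> int) :
  e =1 e' -> run eta n e =1 run eta n e'.
Proof. by move=> ee'; elim: n => // n IHn i; exact: eq_peval. Qed.

Section LoopRuns.
Variables (d : nat) (L : loop d).

Lemma terminating_no_run e : terminating (loop_program L) ->
  holds e (lpre L) -> ~ (forall n, holds (run (lupd L) n e) (lguard L)).
Proof.
move=> term pre_e guard_e; apply: term.
(* The entry transition keeps the state, hence the shift by one. *)
pose f n : config (loop_program L) :=
  if n is n'.+1 then (true, run (lupd L) n' e) else (false, e).
exists f; split=> // -[|n].
  exists (loop_entry L); first by rewrite !inE eqxx.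
  by split=> // v; rewrite /update ffunE; rewrite -> (peval_var e).
exists (loop_body L); first by rewrite !inE eqxx orbT.
by split=> //= v; rewrite /update ffunE.
Qed.

Lemma run_loop_star n e :
  run (lupd (loop_star L)) n e =1 run (lupd L) n.*2 e.
Proof.
elim: n => // n IHn i; rewrite doubleS.
apply: etrans (eq_peval IHn _) _.
exact: (peval_psubst (lupd L) (run (lupd L) n.*2 e) (lupd L i)).
Qed.

Lemma holds_loop_star n e :
  holds (run (lupd (loop_star L)) n e) (lguard (loop_star L)) =
  holds (run (lupd L) n.*2 e) (lguard L) &&
  holds (run (lupd L) n.*2.+1 e) (lguard L).
Proof. by rewrite (holds_ext (run_loop_star n e)) /= holds_psubst. Qed.

Lemma loop_star_pre_inv :
    valid_imp (lpre L) (fsubst (lupd L) (lpre L)) ->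
  valid_imp (lpre (loop_star L))
    (fsubst (lupd (loop_star L)) (lpre (loop_star L))).
Proof.
move=> inv e pre_e; rewrite holds_psubst.
rewrite (holds_ext (run_loop_star 1 e)).
exact: pre_run inv _ 2 pre_e.
Qed.

(** Iteration [n./2] of the composed loop checks the guard of [L] in two consecutive iterations, one
    of which is [n]. *)
Lemma loop_star_no_run e :
    ~ (forall n, holds (run (lupd L) n e) (lguard L)) ->
  ~ (forall n, holds (run (lupd (loop_star L)) n e) (lguard (loop_star L))).
Proof.
move=> no_run guard_e; apply: no_run => n.
have := guard_e n./2; rewrite holds_loop_star => /andP[even_n odd_n].
by rewrite -(odd_double_half n); case: odd.
Qed.

Lemma loop_bound_run (V : choiceType) (PV : {fset V}) (x : 'I_d -> PV)
    (b : bound PV) (sg : V -> int) k :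
    loop_bound x L b -> holds (fun i => sg (val (x i))) (lpre L) ->
    (forall n, (n < k)%N ->
       holds (run (lupd L) n (fun i => sg (val (x i)))) (lguard L)) ->
  omega_le (Some k) (beval (abs_state sg) b).
Proof.
move=> bP pre_e guard_e.
case: bP => [[[inv _] term [q qP ->]]|[[inv _] _ term [q qP ->]]|[_ ->] //].
  have no_run e := @terminating_no_run e term.
  have [B qB leB] := stab_bound_run qP inv no_run pre_e.
  by rewrite (nonneg_beval (stab_bound_coeff_ge0 qP) qB); exact: leB.
have no_run e pre := loop_star_no_run (@terminating_no_run e term pre).
have [B qB leB] := stab_bound_run qP (loop_star_pre_inv inv) no_run pre_e.
rewrite /= (nonneg_beval (stab_bound_coeff_ge0 qP) qB) /=.
(* Each composed iteration uses up two guarded iterations of [L]. Rounding down loses at most one,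
   which accounts for the [+ 1] in the bound. *)
have : (k./2 <= B)%N.
  apply: leB => n nk; rewrite holds_loop_star.
  by apply/andP; split; apply: guard_e; lia.
lia.
Qed.

End LoopRuns.

(** Classically, either there is no finite bound and the supremum is omega, or descent from a bound
    reaches the least one. *)
Lemma sup_exists (A : nat -> Prop) : exists S, is_sup A S.
Proof.
pose ub B := forall k, A k -> (k <= B)%N.
have [[B ubB]|no_ub] := classic (exists B, ub B); last first.
  exists None; split=> // -[u|] // ubu; case: no_ub; exists u; exact: ubu.
have [B' [ubB' minB']] : exists B, ub B /\ forall u, ub u -> (B <= u)%N.
  elim/ltn_ind: B ubB => B IH ubB.
  have [[u [uB ubu]]|min] := classic (exists u, (u < B)%N /\ ub u).
    exact: IH ubu.
  exists B; split=> // u ubu; rewrite leqNgt; apply/negP => uB.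
  by apply: min; exists u.
by exists (Some B'); split=> // -[u|] // ubu; exact: minB'.
Qed.

(** * From program runs to loop iterations *)

Section SelfLoop.
Variables (V : choiceType) (P : program V) (d : nat) (x : 'I_d -> pvars P).
Variables (t : transition (pvars P) (loc P)).
Variables (phi : formula 'I_d) (eta : 'I_d -> mpol int 'I_d).
Hypothesis t_guard : guard t = fsubst (incl x) phi.
Hypothesis t_upd : forall i, update t (x i) = psubst (incl x) (eta i).

Definition loop_state (c : config P) (i : 'I_d) : int := c.2 (val (x i)).

Lemma holds_incl (s : V -> int) f :
  holds s (fsubst (incl x) f) = holds (fun i => s (val (x i))) f.
Proof. by rewrite holds_psubst; apply: holds_ext => i; exact: peval_var. Qed.

(** Only the values of the [x i] are tracked: the guard of [t] and its updates of these variables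
    read nothing else. *)
Definition loop_path (n : nat) (c c' : config P) : Prop :=
  loop_state c' =1 run eta n (loop_state c) /\
  forall m, (m < n)%N -> holds (run eta m (loop_state c)) phi.

Lemma loop_path_cat m n c c' c'' :
  loop_path m c c' -> loop_path n c' c'' -> loop_path (n + m) c c''.
Proof.
case=> cc' guard_c [c'c'' guard_c']; split=> [i|k kmn].
  by rewrite c'c'' run_add; exact: eq_run.
have [/guard_c//|mk] := ltnP k m.
rewrite -(subnK mk) run_add -(holds_ext (eq_run eta (k - m)%N cc')).
by apply: guard_c'; lia.
Qed.

Lemma step_loop_path c c' : step t c c' -> loop_path 1 c c'.
Proof.
case=> _ _; rewrite t_guard holds_incl => guard_c upd.
split=> [i|[|//] _]; last exact: guard_c.
rewrite /loop_state upd t_upd.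
apply: etrans (peval_psubst (incl x) c.2 (eta i)) _.
by apply: eq_peval => j; exact: peval_var.
Qed.

Lemma star_loop_path c c' : star (step_in [fset t]) c c' ->
  exists n, loop_path n c c'.
Proof.
elim=> {c c'} [c c' [t' /fset1P-> /step_loop_path]|c
  |c c' c'' _ [m cm] _ [n cn]].
- by exists 1%N.
- by exists 0%N.
- by exists (n + m)%N; exact: loop_path_cat cm cn.
Qed.

(** Every round ends with a step of [t], and its starred part may add further ones; hence at least
    [k] iterations. *)
Lemma rpow_loop_path k c c' :
    rpow (rcomp (star (step_in [fset t])) (step t)) k c c' ->
  exists2 n, (k <= n)%N & loop_path n c c'.
Proof.
elim: k c => [c ->|k IHk c]; first by exists 0%N.
case=> c2 [c1 /star_loop_path[m pm] /step_loop_path p1] /IHk[n kn pn].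
exists (n + (1 + m))%N; first lia.
by apply: loop_path_cat pn; exact: loop_path_cat p1.
Qed.

End SelfLoop.

Theorem theorem29 (V : choiceType) (P : program V)
  (d : nat) (x : 'I_d -> pvars P) (x_inj : injective x)
  (t : transition (pvars P) (loc P)) (tP : t \in trans P) (l : loc P)
  (t_src : src t = l) (t_tgt : tgt t = l)
  (phi : formula 'I_d) (eta : 'I_d -> mpol int 'I_d)
  (t_guard : guard t = fsubst (incl x) phi)
  (t_upd : forall i, update t (x i) = psubst (incl x) (eta i))
  (t_id : forall v : pvars P, (forall i, v <> x i) -> update t v = pvar (val v))
  (psi : entries [fset t] -> formula 'I_d)
  (psi_inv : forall r, valid_imp (psi r) (fsubst eta (psi r)))
  (psi_reach : forall (r : entries [fset t]) (sg : V -> int),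
     (exists sg0 : V -> int, reach_via (val r) (init P, sg0) (l, sg)) ->
     holds sg (fsubst (incl x) (psi r)))
  (RB : entries [fset t] -> bound (pvars P))
  (RB_def : forall r, loop_bound x (Loop (psi r) phi eta) (RB r)) :
  local_runtime_bound [fset t] [fset t] RB.
Proof.
move=> _ /fset1P-> r sg.
have [S supS] := sup_exists (local_runs [fset t] t (val r) sg).
(* By leastness of the supremum, it suffices that the bound dominates every member of the set. *)
exists S => //; case: supS => _; apply=> k [sg0 [l'' [c' [reach runs]]]].
(* The target of an entry transition is the source of [t]. *)
have l''E : l'' = l.
  have := valP r; rewrite !inE => /andP[_ /hasP[_ /fset1P-> /eqP]].
  by case: reach => c _ [_ /= -> _ _]; rewrite t_src.
rewrite {l''}l''E in reach runs.
have pre : holds (fun i => sg (val (x i))) (psi r).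
  by rewrite -holds_incl; apply: psi_reach; exists sg0.
apply: (loop_bound_run (RB_def r)) => // n nk /=.
have [m km [_]] := rpow_loop_path t_guard t_upd runs.
by apply; exact: leq_trans nk km.
Qed.
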